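(* Let $C=(C_\bullet,d,s,t)$ be an $H$-unital para-precyclic $k$-module and assume that $k\supset\mathbb Q$. Then the cochain map $\bar\nu_\natural:C^\bullet_{T,\natural}\to C^\bullet_\lambda$ given, for $\phi=(\phi_m,\phi_{m-2},\ldots)\in C^m_{T,\natural}$, by $$\bar\nu_\natural(\phi)=\sum_{m-2j\ge0}(-1)^j\,\phi_{m-2j}\circ\left\{[1-(1-\tau)s'\hat Db](\hat b'\hat Db)^j\hat N\right\}$$ is a left-inverse and a cochain homotopy right-inverse of the canonical inclusion $\bar\iota_\natural:C^\bullet_\lambda\to C^\bullet_{T,\natural}$, $\bar\iota_\natural(\phi)=(\phi,0,\ldots)$.
   Context: $k$ is a unital ring, not assumed commutative; $k$-modules are left modules, and $\operatorname{Hom}_k(C_m,k)$ is regarded as a right $k$-module. A para-precyclic $k$-module consists of $k$-modules $C_m$, $m\ge0$, face maps $d_j:C_m\to C_{m-1}$ ($0\le j\le m$) with $d_id_j=d_{j-1}d_i$ for $i<j$, and an invertible $k$-linear map $t:C_\bullet\to C_\bullet$ of degree $0$ with $td_i=d_{i+1}t$ for $0\le i\le m-1$ and $d_m=d_0t$ on $C_m$ (notation: $d=d_m$ on $C_m$). Put $T=t^{m+1}$ on $C_m$; it commutes with $d$ and $t$. Let $b=\sum_{j=0}^m(-1)^jd_j$, $b'=\sum_{j=0}^{m-1}(-1)^jd_j$, $\tau=(-1)^mt$, $N=1+\tau+\cdots+\tau^m$ on $C_m$. It is $H$-unital, written $(C_\bullet,d,s,t)$, when equipped with a $k$-linear map $s:C_\bullet\to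 C_{\bullet+1}$ commuting with $T$ with $b's+sb'=1$. Put $s'=sb's$ and $B=(1-\tau)s'N:C_\bullet\to C_{\bullet+1}$. On $C_m$: $\hat Nx=(m+1)^{-1}Nx$, $\hat Dx=(m+1)^{-1}\sum_{j=0}^m(m-j)\tau^jx$, and $\hat b'x=m^{-1}b'x$ (with $\hat b'x=0$ if $m=0$). Cochains: $C_T^m=\{\phi\in\operatorname{Hom}_k(C_m,k):\phi\circ T=\phi\}$, with $b\phi=\phi\circ b\in C_T^{m+1}$ and $B\phi=\phi\circ B\in C_T^{m-1}$. $C^m_{T,\natural}=C_T^m\oplus C_T^{m-2}\oplus\cdots$, and $(C^\bullet_{T,\natural},b+B)$ is a cochain complex (the dual of $(C^\natural_{T,\bullet},b+Bu^{-1})$, where $C_T=C/\operatorname{ran}(1-T)$). $C_\lambda^m=\{\phi\in\operatorname{Hom}_k(C_m,k):\phi\circ\tau=\phi\}$, and $(C^\bullet_\lambda,b)$ is Connes' cochain complex. $B$ vanishes on cyclic cochains, so $\bar\iota_\natural$ is a cochain map. *)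

(* Defs.v *)
From HB Require Import structures.
From mathcomp Require Import all_boot all_order all_algebra.
From mathcomp Require Import boolp classical_sets functions.
Set Implicit Arguments.
Unset Strict Implicit.
Unset Printing Implicit Defensive.
Import GRing.Theory.
Local Open Scope ring_scope.

(* For a left k-module V, functions V -> k carry the right k-module structure
   (phi a)(x) = phi(x) a. Right k-modules are left modules over k^c. *)
Definition rfun (k : nzRingType) (V : Type) : Type := V -> k.

HB.instance Definition _ (k : nzRingType) (V : Type) :=
  GRing.Zmodule.copy (rfun k V) (V -> k).

Section RightModule.
Variables (k : nzRingType) (V : Type).

Definition rfun_scale (a : k^c) (phi : rfun k V) : rfun k V :=
  fun x => phi x * (a : k).

Lemma rfun_scaleA a b phi :
  rfun_scale a (rfun_scale b phi) = rfun_scale (a * b) phi.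
Proof. by apply/funext => x; rewrite /rfun_scale -mulrA. Qed.

Lemma rfun_scale1 : left_id 1 rfun_scale.
Proof. by move=> phi; apply/funext => x; rewrite /rfun_scale mulr1. Qed.

Lemma rfun_scaleDr : right_distributive rfun_scale +%R.
Proof. by move=> a f g; apply/funext => x; exact: mulrDl. Qed.

Lemma rfun_scaleDl phi : {morph rfun_scale^~ phi : a b / a + b}.
Proof. by move=> a b; apply/funext => x; exact: mulrDr. Qed.

HB.instance Definition _ := GRing.Zmodule_isLmodule.Build k^c (rfun k V)
  rfun_scaleA rfun_scale1 rfun_scaleDr rfun_scaleDl.
End RightModule.

(* The right k-module {phi in Hom_k(V, k) | phi o u = phi}. *)
Section InvariantHom.
Variables (k : nzRingType) (V : lmodType k) (u : V -> V).

Definition inv_hom_pred : {pred rfun k V} :=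
  fun phi => `[< linear (phi : V -> k^o) /\ forall x, phi (u x) = phi x >].

Lemma inv_hom_predP (phi : rfun k V) :
  reflect (linear (phi : V -> k^o) /\ forall x, phi (u x) = phi x)
          (phi \in inv_hom_pred).
Proof. exact: asboolP. Qed.

Lemma inv_hom_closed : submod_closed inv_hom_pred.
Proof.
split.
  apply/inv_hom_predP; split=> // a x y.
  by rewrite [LHS]/= /GRing.scale /= mulr0 addr0.
move=> a f g /inv_hom_predP[fl fu] /inv_hom_predP[gl gu].
apply/inv_hom_predP; split=> [c x y|x].
  have E z : (a *: f + g) z = f z * (a : k) + g z by [].
  rewrite !E fl gl /GRing.scale /= mulrDl mulrDr !mulrA.
  by rewrite -!addrA; congr (_ + _); rewrite addrCA.
have E z : (a *: f + g) z = f z * (a : k) + g z by [].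
by rewrite !E fu gu.
Qed.

HB.instance Definition _ :=
  GRing.isSubmodClosed.Build k^c (rfun k V) inv_hom_pred inv_hom_closed.

Record inv_hom : Type :=
  InvHom { inv_hom_val : rfun k V; _ : inv_hom_val \in inv_hom_pred }.

HB.instance Definition _ := [isSub for inv_hom_val].
HB.instance Definition _ := [Choice of inv_hom by <:].
HB.instance Definition _ := [SubChoice_isSubLmodule of inv_hom by <:].

Definition inv_hom_fun (phi : inv_hom) : V -> k := inv_hom_val phi.
Coercion inv_hom_fun : inv_hom >-> Funclass.

Lemma inv_homP (phi : inv_hom) x : phi (u x) = phi x.
Proof. by case: phi => f /= /inv_hom_predP[]. Qed.

Lemma inv_hom_linear (phi : inv_hom) : linear (phi : V -> k^o).
Proof. by case: phi => f /= /inv_hom_predP[]. Qed.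

HB.instance Definition _ (phi : inv_hom) :=
  GRing.isLinear.Build k V k^o _ (inv_hom_fun phi : V -> k^o) (inv_hom_linear phi).
End InvariantHom.

Section Pullback.
Variables (k : nzRingType) (V W : lmodType k) (u : V -> V) (v : W -> W).
Variables (f : {linear V -> W}).
Hypothesis fuv : forall (phi : inv_hom v) x, phi (f (u x)) = phi (f x).

Lemma pullback_subproof (phi : inv_hom v) :
  (phi \o f : rfun k V) \in inv_hom_pred u.
Proof.
apply/inv_hom_predP; split=> [a x y|]; last exact: fuv.
by rewrite /= linearP inv_hom_linear.
Qed.

Definition pullback (phi : inv_hom v) : inv_hom u :=
  InvHom (pullback_subproof phi).

Lemma pullback_linear : linear pullback.
Proof. by move=> a phi psi; apply/val_inj. Qed.

HB.instance Definition _ := GRing.isLinear.Build k^c (inv_hom v) (inv_hom u) _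
  pullback pullback_linear.
End Pullback.

(* face m j is d_j : C_(m+1) -> C_m, meaningful only for j <= m + 1. Since
   C_(-1) = 0, the faces on C_0 are omitted. *)
Record para_precyclic (k : nzRingType) := ParaPrecyclic {
  pmod :> nat -> lmodType k;
  face : forall m, nat -> {linear pmod m.+1 -> pmod m};
  cyc : forall m, {linear pmod m -> pmod m};
  face_face : forall m i j (x : pmod m.+2), (i < j <= m.+2)%N ->
    face m i (face m.+1 j x) = face m j.-1 (face m.+1 i x);
  cyc_bij : forall m, bijective (cyc m);
  cyc_face : forall m i (x : pmod m.+1), (i <= m)%N ->
    cyc m (face m i x) = face m i.+1 (cyc m.+1 x);
  face_last : forall m (x : pmod m.+1),
    face m m.+1 x = face m 0 (cyc m.+1 x)
}.

Section Operators.
Variables (k : nzRingType) (C : para_precyclic k).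

Definition opT m (x : C m) : C m := iter m.+1 (cyc C m) x.
Definition opb m (x : C m.+1) : C m :=
  \sum_(j < m.+2) (-1) ^+ j *: face C m j x.
Definition opb' m (x : C m.+1) : C m :=
  \sum_(j < m.+1) (-1) ^+ j *: face C m j x.
Definition tau m (x : C m) : C m := (-1) ^+ m *: cyc C m x.
Definition opN m (x : C m) : C m := \sum_(i < m.+1) iter i (@tau m) x.

Lemma scale_sign_linear (V W : lmodType k) (f : {linear V -> W}) n :
  linear (fun x => (-1) ^+ n *: f x).
Proof. by move=> a x y; rewrite linearP scalerDr !scalerA -signr_odd commr_sign. Qed.

Lemma sum_linear (V W : lmodType k) n (f : nat -> V -> W) :
  (forall i, linear (f i)) -> linear (fun x => \sum_(i < n) f i x).
Proof.
move=> fl a x y; rewrite scaler_sumr -big_split /=.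
by apply: eq_bigr => i _; rewrite fl.
Qed.

Lemma iter_linear (V : lmodType k) n (f : V -> V) : linear f -> linear (iter n f).
Proof. by move=> fl; elim: n => [|n IH] a x y //=; rewrite IH fl. Qed.

Lemma opT_linear m : linear (@opT m).
Proof. by apply: iter_linear => a x y; rewrite linearP. Qed.
HB.instance Definition _ m :=
  GRing.isLinear.Build k (C m) (C m) _ (@opT m) (@opT_linear m).

Lemma opb_linear m : linear (@opb m).
Proof.
apply: (@sum_linear _ _ _ (fun i x => (-1) ^+ i *: face C m i x)) => i.
exact: scale_sign_linear.
Qed.
HB.instance Definition _ m :=
  GRing.isLinear.Build k (C m.+1) (C m) _ (@opb m) (@opb_linear m).

Lemma opb'_linear m : linear (@opb' m).
Proof.
apply: (@sum_linear _ _ _ (fun i x => (-1) ^+ i *: face C m i x)) => i.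
exact: scale_sign_linear.
Qed.
HB.instance Definition _ m :=
  GRing.isLinear.Build k (C m.+1) (C m) _ (@opb' m) (@opb'_linear m).

Lemma tau_linear m : linear (@tau m).
Proof. exact: scale_sign_linear. Qed.
HB.instance Definition _ m :=
  GRing.isLinear.Build k (C m) (C m) _ (@tau m) (@tau_linear m).

Lemma opN_linear m : linear (@opN m).
Proof. 
apply: (@sum_linear _ _ _ (fun i => iter i (@tau m))) => i.
by apply: iter_linear; exact: tau_linear. Qed.
HB.instance Definition _ m :=
  GRing.isLinear.Build k (C m) (C m) _ (@opN m) (@opN_linear m).

Lemma iter_cyc_face m i n (x : C m.+1) : (i + n <= m.+1)%N ->
  iter n (cyc C m) (face C m i x) = face C m (i + n) (iter n (cyc C m.+1) x).
Proof.
elim: n => [|n IH] /=; first by rewrite addn0.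
by rewrite addnS => le_in; rewrite IH 1?ltnW // cyc_face.
Qed.

Lemma opT_face m j (x : C m.+1) : (j <= m.+1)%N ->
  opT (face C m j x) = face C m j (opT x).
Proof.
move=> le_jm; rewrite /opT.
have E (V : Type) (f : V -> V) y :
  iter m.+1 f y = iter j f (iter (m.+1 - j) f y) by rewrite -iterD subnKC.
rewrite [LHS]E iter_cyc_face ?subnKC // face_last -iterS.
by rewrite iter_cyc_face // add0n -iterD addnS subnKC.
Qed.

Lemma opT_cyc m (x : C m) : opT (cyc C m x) = cyc C m (opT x).
Proof. by rewrite /opT -iterSr. Qed.

Lemma opT_tau m (x : C m) : opT (tau x) = tau (opT x).
Proof. by rewrite /tau linearZ /= opT_cyc. Qed.

Lemma opT_b m (x : C m.+1) : opT (opb x) = opb (opT x).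
Proof.
rewrite /opb linear_sum; apply: eq_bigr => j _.
by rewrite linearZ /= opT_face // -ltnS.
Qed.

Lemma opT_b' m (x : C m.+1) : opT (opb' x) = opb' (opT x).
Proof.
rewrite /opb' linear_sum; apply: eq_bigr => j _.
by rewrite linearZ /= opT_face // ltnW.
Qed.

Lemma opT_N m (x : C m) : opT (opN x) = opN (opT x).
Proof.
rewrite /opN linear_sum; apply: eq_bigr => i _.
by elim: (nat_of_ord i) => //= n <-; rewrite opT_tau.
Qed.

Lemma opT_iter_tau m (x : C m) : opT x = iter m.+1 (@tau m) x.
Proof.
have E n : iter n (@tau m) x = (-1) ^+ (m * n) *: iter n (cyc C m) x.
  elim: n => [|n IH] /=; first by rewrite muln0 scale1r.
  by rewrite IH /tau linearZ /= scalerA -exprD mulnS.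
by rewrite E -signr_odd oddM /= andbN scale1r.
Qed.

Lemma opb_tau m (x : C m.+1) : opb (tau x) = opb x - opb' x + tau (opb' x).
Proof.
rewrite {1}/opb big_ord_recl /=.
have -> : opb x - opb' x = (-1) ^+ m.+1 *: face C m m.+1 x.
  by rewrite /opb big_ord_recr /= -/(opb' x) addrAC subrr add0r.
rewrite expr0 scale1r {1}/tau linearZ /= -face_last; congr (_ + _).
rewrite /opb' linear_sum; apply: eq_bigr => i _.
have le_im : (i <= m)%N by rewrite -ltnS.
rewrite !linearZ /= /tau cyc_face // !scalerA -!exprD; congr (_ *: _).
rewrite -signr_odd -[RHS]signr_odd !oddD /=.
by case: (odd i); case: (odd m).
Qed.
End Operators.

Record hunital (k : nzRingType) := HUnital {
  hbase :> para_precyclic k;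
  contr : forall m, {linear hbase m -> hbase m.+1};
  contr_T : forall m (x : hbase m), contr m (opT x) = opT (contr m x);
  (* the relation b's + sb' = 1 on C_0 (where b' = 0) and on C_(m+1) *)
  contr_b'0 : forall x : hbase 0, opb' (contr 0 x) = x;
  contr_b' : forall m (x : hbase m.+1),
    opb' (contr m.+1 x) + contr m (opb' x) = x
}.

Section OperatorB.
Variables (k : nzRingType) (C : hunital k).

Definition ops' m (x : C m) : C m.+1 := contr C m (opb' (contr C m x)).
Definition opB m (x : C m) : C m.+1 := ops' (opN x) - tau (ops' (opN x)).

Lemma ops'_linear m : linear (@ops' m).
Proof. by move=> a x y; rewrite /ops' !linearP. Qed.
HB.instance Definition _ m :=
  GRing.isLinear.Build k (C m) (C m.+1) _ (@ops' m) (@ops'_linear m).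

Lemma opB_linear m : linear (@opB m).
Proof.
by move=> a x y; rewrite /opB !linearP /= scalerDr addrACA.
Qed.
HB.instance Definition _ m :=
  GRing.isLinear.Build k (C m) (C m.+1) _ (@opB m) (@opB_linear m).

Lemma opT_s' m (x : C m) : opT (ops' x) = ops' (opT x).
Proof. by rewrite /ops' -contr_T opT_b' -contr_T. Qed.

Lemma opT_B m (x : C m) : opT (opB x) = opB (opT x).
Proof. by rewrite /opB linearB /= opT_tau !opT_s' opT_N. Qed.
End OperatorB.

Section Cochains.
Variables (k : nzRingType) (C : hunital k).

Definition CT m : lmodType k^c := inv_hom (@opT k C m).
Definition Clam m : lmodType k^c := inv_hom (@tau k C m).

Lemma CT_b_subproof m (phi : CT m) (x : C m.+1) :
  phi (opb (opT x)) = phi (opb x).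
Proof. by rewrite -opT_b inv_homP. Qed.
Definition CT_b m : {linear CT m -> CT m.+1} :=
  pullback (@CT_b_subproof m).

Lemma CT_B_subproof m (phi : CT m.+1) (x : C m) :
  phi (opB (opT x)) = phi (opB x).
Proof. by rewrite -opT_B inv_homP. Qed.
Definition CT_B m : {linear CT m.+1 -> CT m} :=
  pullback (@CT_B_subproof m).

Lemma Clam_b_subproof m (phi : Clam m) (x : C m.+1) :
  phi (opb (tau x)) = phi (opb x).
Proof.
by rewrite opb_tau linearD linearB /= inv_homP subrK.
Qed.
Definition Clam_b m : {linear Clam m -> Clam m.+1} :=
  pullback (@Clam_b_subproof m).

Lemma Clam_CT_subproof m (phi : Clam m) (x : C m) :
  phi (idfun (opT x)) = phi (idfun x).
Proof.
rewrite /= opT_iter_tau; elim: m.+1 => //= n IH.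
by rewrite inv_homP.
Qed.
Definition Clam_CT m : {linear Clam m -> CT m} :=
  pullback (@Clam_CT_subproof m).

(* C_T^m (+) C_T^(m-2) (+) ... *)
Fixpoint CTnat m : lmodType k^c :=
  match m with
  | 0 => CT 0
  | 1 => CT 1
  | n.+2 => (CT n.+2 * CTnat n)%type : lmodType k^c
  end.

Definition CTnat_head m : CT m -> CTnat m :=
  match m with
  | 0 => fun phi => phi
  | 1 => fun phi => phi
  | n.+2 => fun phi => (phi, 0)
  end.

(* (b + B)(phi_m, phi_(m-2), ...)
     = (b phi_m, B phi_m + b phi_(m-2), B phi_(m-2) + b phi_(m-4), ...) *)
Fixpoint CTnat_dfun m : CTnat m -> CTnat m.+1 :=
  match m with
  | 0 => fun phi => CT_b 0 phi
  | 1 => fun phi => (CT_b 1 phi, CT_B 0 phi)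
  | n.+2 => fun phi =>
      (CT_b n.+2 phi.1, CTnat_head (CT_B n.+1 phi.1) + CTnat_dfun phi.2)
  end.

(* The component phi_(m - 2j) of phi; used only when 2j <= m. *)
Fixpoint CTnat_comp j m : CTnat m -> CT (m - j.*2) :=
  match j, m with
  | 0, 0 => fun phi => phi
  | 0, 1 => fun phi => phi
  | 0, n.+2 => fun phi => phi.1
  | j'.+1, n.+2 => fun phi => @CTnat_comp j' n phi.2
  | j'.+1, _ => fun _ => 0
  end.

Lemma CTnat_head_linear m : linear (@CTnat_head m).
Proof.
case: m => [|[|n]] a phi psi //=.
transitivity ((a *: phi + psi, a *: 0 + 0) : CTnat n.+2) => //.
by rewrite scaler0 addr0.
Qed.
HB.instance Definition _ m := GRing.isLinear.Build k^c (CT m) (CTnat m) _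
  (@CTnat_head m) (@CTnat_head_linear m).

Lemma CTnat_dfun_linear m : linear (@CTnat_dfun m).
Proof.
suff: linear (@CTnat_dfun m) /\ linear (@CTnat_dfun m.+1) by case.
elim: m => [|n [IH0 IH1]]; split=> //.
- by move=> a phi psi; rewrite /= linearP.
- by move=> a phi psi; rewrite /= !linearP.
move=> a [phi1 phi2] [psi1 psi2].
transitivity ((CT_b n.+2 (a *: phi1 + psi1),
  CTnat_head (CT_B n.+1 (a *: phi1 + psi1)) +
  CTnat_dfun (a *: phi2 + psi2 : CTnat n)) : CTnat n.+3) => //.
by rewrite IH0 !linearP addrACA -scalerDr.
Qed.
HB.instance Definition _ m := GRing.isLinear.Build k^c (CTnat m) (CTnat m.+1) _
  (@CTnat_dfun m) (@CTnat_dfun_linear m).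

Definition CTnat_d m : {linear CTnat m -> CTnat m.+1} := @CTnat_dfun m.

Definition iota_nat m : {linear Clam m -> CTnat m} :=
  @CTnat_head m \o Clam_CT m.

Lemma iota_nat_d m (phi : Clam m) :
  CTnat_d m (iota_nat m phi) = iota_nat m.+1 (Clam_b m phi).
Proof.
have B0 n (psi : Clam n.+1) : CT_B n (Clam_CT n.+1 psi) = 0.
  apply/val_inj/funext => x.
  transitivity (psi (opB x)) => //.
  by rewrite /opB linearB /= inv_homP subrr.
have bE n (psi : Clam n) :
  CT_b n (Clam_CT n psi) = Clam_CT n.+1 (Clam_b n psi) by exact/val_inj.
case: m phi => [|[|n]] phi; first exact: bE.
- transitivity ((CT_b 1 (Clam_CT 1 phi), CT_B 0 (Clam_CT 1 phi)) : CTnat 2) => //.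
  by rewrite B0 bE.
- transitivity ((CT_b n.+2 (Clam_CT n.+2 phi),
    CTnat_head (CT_B n.+1 (Clam_CT n.+2 phi)) + CTnat_d n 0)
    : CTnat n.+3) => //.
  by rewrite B0 bE !linear0 addr0.
Qed.
End Cochains.

(* rk : {rmorphism rat -> k}, necessarily unique and injective, expresses that
   k contains the field of rational numbers. *)
Section Nu.
Variables (k : nzRingType) (rk : {rmorphism rat -> k}) (C : hunital k).

Definition inv_nat (n : nat) : k := rk (n%:R^-1).

Definition hatN m (x : C m) : C m := inv_nat m.+1 *: opN x.
Definition hatD m (x : C m) : C m :=
  inv_nat m.+1 *: \sum_(j < m.+1) iter j (@tau k C m) x *+ (m - j).
Definition hatb' m (x : C m.+1) : C m := inv_nat m.+1 *: opb' x.

Definition hatbDb m (x : C m.+2) : C m := hatb' (hatD (opb x)).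

(* The j-th power of hatbDb on C_m; used only when 2j <= m. *)
Fixpoint hatbDb_iter j m : C m -> C (m - j.*2)%N :=
  match j, m with
  | 0, 0 => fun x => x
  | 0, n.+1 => fun x => x
  | j'.+1, n.+2 => fun x => @hatbDb_iter j' n (hatbDb x)
  | j'.+1, _ => fun _ => 0
  end.

(* 1 - (1 - tau) s' hatD b, where b = 0 on C_0 *)
Definition nu_factor m : C m -> C m :=
  match m with
  | 0 => fun x => x
  | n.+1 => fun x =>
      x - (ops' (hatD (opb x)) - tau (ops' (hatD (opb x))))
  end.

Definition nu_formula m (phi : CTnat C m) (x : C m) : k :=
  \sum_(j < m./2.+1)
    (-1) ^+ j * CTnat_comp j phi (nu_factor (hatbDb_iter j (hatN x))).
End Nu.

Section CochainMaps.
Variables (R : pzRingType) (X Y : nat -> lmodType R).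
Variables (dX : forall m, {linear X m -> X m.+1}).
Variables (dY : forall m, {linear Y m -> Y m.+1}).

Definition is_cochain_map (f : forall m, {linear X m -> Y m}) : Prop :=
  forall m x, f m.+1 (dX m x) = dY m (f m x).

(* The complexes vanish in degree -1. *)
Definition cochain_homotopic (f g : forall m, {linear X m -> Y m}) : Prop :=
  exists h : forall m, {linear X m.+1 -> Y m},
    (forall x, f 0%N x - g 0%N x = h 0%N (dX 0%N x)) /\
    (forall m x, f m.+1 x - g m.+1 x = dY m (h m x) + h m.+1 (dX m.+1 x)).
End CochainMaps.

(* Main.v *)
From HB Require Import structures.
Require Import Defs.
From mathcomp Require Import all_boot all_algebra.
From mathcomp Require Import boolp.

(** All cochains are T-invariant, so the operators b, b', tau, N, s', hatD are
    studied through their transposes on T-invariant cochains, where T = 1 holds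
    exactly and one has the usual relations of a precyclic module: with q the
    transpose of 1 - tau (and the other letters denoting transposes too),
    q b = b' q, N b' = b N, q N = N q = 0, q D = D q = 1 - hatN, and s' is a
    contraction of b' of square zero.

    The cyclic bicomplex (columns alternately b and - b', rows alternately
    1 - tau and N) has contractible rows, by hatD and division by the length
    m + 1. Perturbing this row contraction by the columns contracts the total
    complex onto Connes' complex, and eliminating the columns b' with s' leads
    to the complex of the theorem. What comes out is the map nu of the statement
    together with an explicit homotopy, and the proof verifies these formulas.

    Write Phi for nu without the final average hatN. It has the form
    Phi = top - b A, where top is the leading component and A is built with D.
    The key identity is A d = (1 - hatN) Phi (lemma A_d), proved by descending
    along the tail of the cochain. It implies Phi d = b hatN Phi (lemma Phi_d),
    which gives the cochain map property. A cyclic cochain has q = 0, so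
    Phi and hatN do not change it: this is the left inverse property.

    For the homotopy, A is completed by a term G that comes from inverting N.
    Applied to every component, A + G gives a map W for which d W + W d = 1 up
    to a defect in the leading component (lemma periodic_homotopyP), caused by the
    truncation of the complex there. Leaving out G in the leading component
    replaces this defect by hatN Phi, that is, by iota nu. *)

Set Implicit Arguments.
Unset Strict Implicit.
Unset Printing Implicit Defensive.
Import GRing.Theory.
Local Open Scope ring_scope.

(** Transposition turns the left scalars of the hatted operators into right
    scalars on cochains; the two agree because rational scalars are central. *)
Lemma rat_scalar_central (k : nzRingType) (rk : {rmorphism rat -> k}) q
    (x : k) :
  rk q * x = x * rk q.
Proof.
have cint (n : int) y : rk n%:~R * y = y * rk n%:~R.
  by rewrite rmorph_int mulrzl mulrzr.
have d0 : (denq q)%:~R != 0 :> rat by rewrite intr_eq0 denq_neq0.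
set d := rk (denq q)%:~R; set u := rk (denq q)%:~R^-1.
have ud : u * d = 1 by rewrite -rmorphM mulVf // rmorph1.
have du : d * u = 1 by rewrite -rmorphM mulfV // rmorph1.
have cu y : u * y = y * u.
  rewrite -[LHS]mulr1 -{1}du !mulrA -[u * y * d]mulrA -(cint (denq q)) -/d.
  by rewrite [u * _]mulrA ud mul1r.
have -> : rk q = rk (numq q)%:~R * u by rewrite -rmorphM divq_num_den.
by rewrite -mulrA cu mulrA cint mulrA.
Qed.

Lemma inv_natK (k : nzRingType) (rk : {rmorphism rat -> k}) n :
  inv_nat rk n.+1 *+ n.+1 = 1.
Proof.
have e : n.+1%:R^-1 *+ n.+1 = 1 :> rat.
  by rewrite -[LHS]mulr_natr mulVf // Num.Theory.pnatr_eq0.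
by rewrite /inv_nat -raddfMn /= e; exact: rmorph1.
Qed.

(** * Identities between chains *)

(** Truncating the alternating sums one index apart covers both b b = 0
    (p = m + 2) and b' b' = 0 (p = m + 1): raising p by one adds the terms
    d_p d_i and d_i d_(p+1), which cancel by d_i d_(p+1) = d_p d_i. *)
Lemma faces_alternate (k : nzRingType) (C : para_precyclic k) m p (x : C m.+2) :
  (p <= m.+2)%N ->
  \sum_(i < p) (-1) ^+ i *: face C m i
    (\sum_(j < p.+1) (-1) ^+ j *: face C m.+1 j x) = 0.
Proof.
elim: p => [|p IHp] lep; first by rewrite big_ord0.
rewrite (eq_bigr (fun i : 'I_p.+1 => (-1) ^+ i *: face C m i
   (\sum_(j < p.+1) (-1) ^+ j *: face C m.+1 j x) + (-1) ^+ i *: face C m i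
   ((-1) ^+ p.+1 *: face C m.+1 p.+1 x))); last first.
  by move=> i _; rewrite big_ord_recr linearD scalerDr.
rewrite big_split /= big_ord_recr /= IHp 1?ltnW // add0r.
rewrite linear_sum scaler_sumr -big_split /= big1 // => i _.
rewrite !linearZ /= [face C m i _]face_face ?ltn_ord //= !scalerA -!exprD.
by rewrite addnS exprS mulN1r addnC scaleNr subrr.
Qed.

Lemma central_scale_linear (k : nzRingType) (V W : lmodType k) (a : k)
    (f : V -> W) :
  (forall c, a * c = c * a) -> linear f -> linear (fun x => a *: f x).
Proof.
by move=> aC fl c x y; rewrite fl scalerDr !scalerA aC.
Qed.

Section Chains.
Context {k : nzRingType} (rk : {rmorphism rat -> k}) {C : hunital k}.
Implicit Types m n : nat.

Lemma hatN_linear m : linear (@hatN k rk C m).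
Proof.
by apply: central_scale_linear; [exact: rat_scalar_central | exact: linearP].
Qed.
HB.instance Definition _ m :=
  GRing.isLinear.Build k (C m) (C m) _ (@hatN k rk C m) (@hatN_linear m).

Lemma hatD_linear m : linear (@hatD k rk C m).
Proof.
apply: central_scale_linear; first exact: rat_scalar_central.
apply: (@sum_linear _ _ _ _ (fun j x => iter j (@tau k C m) x *+ (m - j))).
move=> j a x y; rewrite (@iter_linear _ _ j (@tau k C m)); last exact: linearP.
by rewrite mulrnDl -scalerMnr.
Qed.
HB.instance Definition _ m :=
  GRing.isLinear.Build k (C m) (C m) _ (@hatD k rk C m) (@hatD_linear m).

(** s' divided by the length of the cyclic action on its target, which makes
    hats' and N on C_(m+1) combine to s' and hatN. *)
Definition hats' m (x : C m) : C m.+1 := inv_nat rk m.+2 *: ops' x.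

Lemma hats'_linear m : linear (@hats' m).
Proof.
by apply: central_scale_linear; [exact: rat_scalar_central | exact: linearP].
Qed.
HB.instance Definition _ m :=
  GRing.isLinear.Build k (C m) (C m.+1) _ (@hats' m) (@hats'_linear m).

Lemma opT_hats' m (x : C m) : opT (hats' x) = hats' (opT x).
Proof. by rewrite /hats' linearZ /= opT_s'. Qed.

Definition one_sub_tau m (x : C m) : C m := x - tau x.

Lemma one_sub_tau_linear m : linear (@one_sub_tau m).
Proof.
by move=> a x y; rewrite /one_sub_tau linearP scalerBr opprD addrACA.
Qed.
HB.instance Definition _ m :=
  GRing.isLinear.Build k (C m) (C m) _ (@one_sub_tau m) (@one_sub_tau_linear m).

Lemma opT_iter_tauC m j (x : C m) :
  opT (iter j (@tau k C m) x) = iter j (@tau k C m) (opT x).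
Proof. by elim: j => //= j <-; rewrite opT_tau. Qed.

Lemma opN_one_sub_tau m (x : C m) : opN (one_sub_tau x) = x - opT x.
Proof.
rewrite linearB /= /opN opT_iter_tau.
elim: m.+1 => [|n IHn]; first by rewrite !big_ord0 !subrr.
by rewrite !big_ord_recr /= opprD addrACA IHn -iterSr addrA subrK.
Qed.

Lemma one_sub_tau_opN m (x : C m) : one_sub_tau (opN x) = x - opT x.
Proof.
rewrite -opN_one_sub_tau linearB /=; congr (_ - _).
rewrite /opN linear_sum; apply: eq_bigr => i _.
by rewrite -iterS iterSr.
Qed.

(** Summation by parts: hatD inverts 1 - tau off the averages hatN. This and
    the next lemma make the rows of the cyclic bicomplex contractible. *)
Lemma one_sub_tau_hatD m (x : C m) : one_sub_tau (hatD rk x) = x - hatN rk x.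
Proof.
have {2}-> : x = inv_nat rk m.+1 *: (x *+ m.+1).
  by rewrite -scaler_nat scalerA mulr_natr inv_natK scale1r.
rewrite /one_sub_tau /hatD /hatN [tau (_ *: _)]linearZ -!scalerBr.
congr (_ *: _).
rewrite linear_sum /= big_ord_recl [X in _ - X]big_ord_recr /=.
rewrite subnn mulr0n linear0 addr0 subn0 /opN big_ord_recl /=.
rewrite mulrS opprD addrACA subrr add0r -addrA; congr (_ + _).
rewrite -sumrB -sumrN; apply: eq_bigr => j _.
rewrite linearMn /= !add0n -(subnSK (ltn_ord j)) mulrSr opprD.
by rewrite addrA subrr add0r.
Qed.

Lemma hatD_one_sub_tau m (x : C m) : hatD rk (one_sub_tau x) = x - hatN rk x.
Proof.
rewrite -one_sub_tau_hatD linearB /=; congr (_ - _).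
rewrite /hatD linearZ /= linear_sum; congr (_ *: _).
by apply: eq_bigr => j _; rewrite linearMn /= -iterS iterSr.
Qed.

Lemma opT_hatN m (x : C m) : opT (hatN rk x) = hatN rk (opT x).
Proof. by rewrite /hatN linearZ /= opT_N. Qed.

Lemma opT_hatD m (x : C m) : opT (hatD rk x) = hatD rk (opT x).
Proof.
rewrite /hatD linearZ /= linear_sum; congr (_ *: _).
by apply: eq_bigr => i _; rewrite linearMn /= opT_iter_tauC.
Qed.

Lemma hatb'_linear m : linear (@hatb' k rk C m).
Proof.
by apply: central_scale_linear; [exact: rat_scalar_central | exact: linearP].
Qed.
HB.instance Definition _ m :=
  GRing.isLinear.Build k (C m.+1) (C m) _ (@hatb' k rk C m) (@hatb'_linear m).

Lemma opT_hatb' m (x : C m.+1) : opT (hatb' rk x) = hatb' rk (opT x).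
Proof. by rewrite /hatb' linearZ /= opT_b'. Qed.

Lemma opT_one_sub_tau m (x : C m) : opT (one_sub_tau x) = one_sub_tau (opT x).
Proof. by rewrite linearB /= opT_tau. Qed.

Lemma bb0 m (x : C m.+2) : opb (opb x) = 0.
Proof. exact: faces_alternate. Qed.

Lemma b'b'0 m (x : C m.+2) : opb' (opb' x) = 0.
Proof. exact: faces_alternate. Qed.

(** b' s b' = (1 - s b') b' = b'. Hence s' b' = s b' and b' s' = b' s, so that
    s' is again a contraction of b', now with s' s' = 0. *)
Lemma b'sb' m (x : C m.+1) : opb' (contr C m (opb' x)) = opb' x.
Proof.
case: m x => [|m] x; first exact: contr_b'0.
by rewrite -[RHS]contr_b' b'b'0 linear0 addr0.
Qed.

Lemma s'b' m (x : C m.+1) : ops' (opb' x) = contr C m (opb' x).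
Proof. by rewrite /ops' b'sb'. Qed.

Lemma b's' m (x : C m) : opb' (ops' x) = opb' (contr C m x).
Proof. by rewrite /ops' b'sb'. Qed.

Lemma s's' m (x : C m) : ops' (ops' x) = 0.
Proof.
have := contr_b' (contr C m (opb' (contr C m x))).
rewrite b'sb' => /(canRL (addrK _)); rewrite subrr => e.
by rewrite /ops' e linear0.
Qed.

End Chains.

(** * Transposed operators on T-invariant cochains *)

Section Dual.
Context {k : nzRingType} (rk : {rmorphism rat -> k}) {C : hunital k}.
Implicit Types m n : nat.
Local Notation V := (CT C).

Lemma CT_ext n (phi psi : V n) : (forall x, phi x = psi x) -> phi = psi.
Proof. by move=> e; apply/val_inj/funext. Qed.

Lemma CT_scaleE n (a : k^c) (phi : V n) x : (a *: phi) x = phi x * (a : k).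
Proof. by []. Qed.

Lemma transpose_subproof m n (f : {linear C m -> C n})
    (fT : forall x, f (opT x) = opT (f x)) (phi : V n) x :
  phi (f (opT x)) = phi (f x).
Proof. by rewrite fT inv_homP. Qed.

Definition transpose m n f fT : {linear V n -> V m} :=
  pullback (@transpose_subproof m n f fT).

Definition dual_one_sub_tau n : {linear V n -> V n} :=
  @transpose n n (@one_sub_tau k C n) (fun x => esym (opT_one_sub_tau x)).
Definition dual_N n : {linear V n -> V n} :=
  @transpose n n (@opN k C n) (fun x => esym (opT_N x)).
Definition dual_hatN n : {linear V n -> V n} :=
  @transpose n n (@hatN k rk C n) (fun x => esym (opT_hatN rk x)).
Definition dual_hatD n : {linear V n -> V n} :=
  @transpose n n (@hatD k rk C n) (fun x => esym (opT_hatD rk x)).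
Definition dual_b n : {linear V n -> V n.+1} := CT_b C n.
Definition dual_B n : {linear V n.+1 -> V n} := CT_B C n.
Definition dual_b' n : {linear V n -> V n.+1} :=
  @transpose n.+1 n (@opb' k C n) (fun x => esym (opT_b' x)).
Definition dual_hatb' n : {linear V n -> V n.+1} :=
  @transpose n.+1 n (@hatb' k rk C n) (fun x => esym (opT_hatb' rk x)).
Definition dual_s' n : {linear V n.+1 -> V n} :=
  @transpose n n.+1 (@ops' k C n) (fun x => esym (opT_s' x)).
Definition dual_hats' n : {linear V n.+1 -> V n} :=
  @transpose n n.+1 (@hats' k rk C n) (fun x => esym (opT_hats' rk x)).

Arguments dual_one_sub_tau : simpl never.
Arguments dual_N : simpl never.
Arguments dual_hatN : simpl never.
Arguments dual_hatD : simpl never.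
Arguments dual_b : simpl never.
Arguments dual_B : simpl never.
Arguments dual_b' : simpl never.
Arguments dual_hatb' : simpl never.
Arguments dual_s' : simpl never.
Arguments dual_hats' : simpl never.

(* In operator identities between cochains, a composite is the transpose of the
   composite taken in the opposite order on chains. *)
Local Notation q := dual_one_sub_tau.
Local Notation N := dual_N.
Local Notation Nh := dual_hatN.
Local Notation D := dual_hatD.
Local Notation b := dual_b.
Local Notation b' := dual_b'.
Local Notation bh := dual_hatb'.
Local Notation s := dual_s'.
Local Notation sh := dual_hats'.
Local Notation B := dual_B.

Lemma NhE n (phi : V n) : Nh n phi = (inv_nat rk n.+1 : k^c) *: N n phi.
Proof.
apply: CT_ext => x; rewrite CT_scaleE -(rat_scalar_central rk).
exact: (linearZ_LR (phi : {linear C n -> k^o})).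
Qed.

Lemma bhE n (phi : V n) : bh n phi = (inv_nat rk n.+1 : k^c) *: b' n phi.
Proof.
apply: CT_ext => x; rewrite CT_scaleE -(rat_scalar_central rk).
exact: (linearZ_LR (phi : {linear C n -> k^o})).
Qed.

Lemma shE n (phi : V n.+1) : sh n phi = (inv_nat rk n.+2 : k^c) *: s n phi.
Proof.
apply: CT_ext => x; rewrite CT_scaleE -(rat_scalar_central rk).
exact: (linearZ_LR (phi : {linear C n.+1 -> k^o})).
Qed.

Lemma BE n (phi : V n.+1) : B n phi = N n (s n (q n.+1 phi)).
Proof. by apply: CT_ext. Qed.

Lemma q_b n (phi : V n) : q n.+1 (b n phi) = b' n (q n phi).
Proof.
apply: CT_ext => x.
rewrite -[LHS]/(phi (opb (one_sub_tau x))) -[RHS]/(phi (one_sub_tau (opb' x))).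
by rewrite linearB /= opb_tau opprD opprB addrA (addrCA (opb x)) subrr addr0.
Qed.

Lemma b_b n (phi : V n) : b n.+1 (b n phi) = 0.
Proof.
by apply: CT_ext => x; rewrite -[LHS]/(phi (opb (opb x))) bb0 linear0.
Qed.

Lemma b'_b' n (phi : V n) : b' n.+1 (b' n phi) = 0.
Proof.
by apply: CT_ext => x; rewrite -[LHS]/(phi (opb' (opb' x))) b'b'0 linear0.
Qed.

Lemma N_q n (phi : V n) : N n (q n phi) = 0.
Proof.
apply: CT_ext => x; rewrite -[LHS]/(phi (one_sub_tau (opN x))).
by rewrite one_sub_tau_opN linearB /= inv_homP subrr.
Qed.

Lemma q_N n (phi : V n) : q n (N n phi) = 0.
Proof.
apply: CT_ext => x; rewrite -[LHS]/(phi (opN (one_sub_tau x))).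
by rewrite opN_one_sub_tau linearB /= inv_homP subrr.
Qed.

Lemma q_D n (phi : V n) : q n (D n phi) = phi - Nh n phi.
Proof.
apply: CT_ext => x; rewrite -[LHS]/(phi (hatD rk (one_sub_tau x))).
by rewrite hatD_one_sub_tau linearB.
Qed.

Lemma q_Nh n (phi : V n) : q n (Nh n phi) = 0.
Proof. by rewrite NhE linearZ_LR q_N ?scaler0. Qed.

Lemma D_q n (phi : V n) : D n (q n phi) = phi - Nh n phi.
Proof.
apply: CT_ext => x; rewrite -[LHS]/(phi (one_sub_tau (hatD rk x))).
by rewrite one_sub_tau_hatD linearB.
Qed.

Lemma s_b'0 (phi : V 0) : s 0 (b' 0 phi) = phi.
Proof.
apply: CT_ext => x; rewrite -[LHS]/(phi (opb' (ops' x))).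
by rewrite b's' contr_b'0.
Qed.

Lemma s_b' n (phi : V n.+1) : s n.+1 (b' n.+1 phi) = phi - b' n (s n phi).
Proof.
apply: CT_ext => x; rewrite -[LHS]/(phi (opb' (ops' x))).
rewrite -[RHS]/(phi x - phi (ops' (opb' x))) -linearB /=.
by rewrite b's' s'b' -{2}(contr_b' x) addrK.
Qed.

Lemma s_s n (phi : V n.+2) : s n (s n.+1 phi) = 0.
Proof.
by apply: CT_ext => x; rewrite -[LHS]/(phi (ops' (ops' x))) s's' linear0.
Qed.

(** The relation d_(i+1) tau = - tau d_i lets all signed faces agree once
    averaged on both sides. *)
Lemma N_face_N m i (phi : V m) (x : C m.+1) : (i <= m.+1)%N ->
  phi (opN (face C m i (opN x))) =
  (-1) ^+ i * phi (opN (face C m 0 (opN x))).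
Proof.
elim: i => [|i IHi] le_im; first by rewrite mul1r.
rewrite exprS -mulrA -IHi ?(ltnW le_im) // mulN1r.
have N_tau z : phi (opN (tau z)) = phi (opN z).
  apply/eqP; rewrite eq_sym -subr_eq0 -!linearB /= -/(one_sub_tau z).
  by rewrite opN_one_sub_tau linearB /= inv_homP subrr.
have tauNx : tau (opN x) = opN x - (x - opT x).
  by rewrite -one_sub_tau_opN /one_sub_tau opprB addrC subrK.
have -> : phi (opN (face C m i.+1 (opN x))) =
    phi (opN (face C m i.+1 (tau (opN x)))).
  by rewrite tauNx !linearB /= -opT_face // -opT_N inv_homP subrr addr0.
rewrite -(N_tau (face C m i (opN x))) -linearN -linearN /=; congr (phi (opN _)).
by rewrite /tau linearZ /= -cyc_face // exprS mulN1r scaleNr.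
Qed.

Lemma N_b_N n (phi : V n) :
  N n.+1 (b n (N n phi)) *+ n.+1 = N n.+1 (b' n (N n phi)) *+ n.+2.
Proof.
have E p (x : C n.+1) : (p <= n.+2)%N ->
    phi (opN (\sum_(i < p) (-1) ^+ i *: face C n i (opN x))) =
    phi (opN (face C n 0 (opN x))) *+ p.
  move=> le_p; rewrite [opN (\sum_(i < p) _)]linear_sum [LHS]linear_sum.
  rewrite -[in RHS](card_ord p) -sumr_const; apply: eq_big => // i _.
  rewrite /= [opN (_ *: _)]linearZ_LR [LHS]linearZ_LR /= N_face_N.
    exact: (signrMK i).
  by rewrite -ltnS (leq_trans (ltn_ord i)).
have mulnE (psi : V n.+1) x p : (psi *+ p) x = psi x *+ p.
  by elim: p => //= p IHp; rewrite !mulrS -IHp.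
apply: CT_ext => x; rewrite !mulnE.
have -> : N n.+1 (b n (N n phi)) x = phi (opN (opb (opN x))) by [].
have -> : N n.+1 (b' n (N n phi)) x = phi (opN (opb' (opN x))) by [].
by rewrite /opb /opb' !E // -!mulrnA mulnC.
Qed.

Lemma scaleK n (phi : V n) m : (inv_nat rk m.+1 : k^c) *: phi *+ m.+1 = phi.
Proof.
rewrite -scaler_nat scalerA mulr_natl.
by rewrite (inv_natK rk m : (inv_nat rk m.+1 : k^c) *+ m.+1 = 1) scale1r.
Qed.

(** Both sides of N b' = b N (transposed: b' N = N b) are averaged already: b N
    takes values killed by 1 - tau, and N b' kills the range of 1 - tau. They
    can therefore be compared after averaging on both sides, where only the
    number of faces in b and b' matters. *)
Lemma N_b' n (phi : V n) : N n.+1 (b' n phi) = b n (N n phi).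
Proof.
have e1 : b n (N n phi) = (inv_nat rk n.+2 : k^c) *: N n.+1 (b n (N n phi)).
  by apply/eqP; rewrite -subr_eq0 -NhE -D_q q_b q_N !linear0.
have e2 : N n.+1 (b' n phi) =
    (inv_nat rk n.+1 : k^c) *: N n.+1 (b' n (N n phi)).
  rewrite -{1}(subrK (Nh n phi) phi) -q_D !linearD -q_b N_q add0r NhE.
  by rewrite !linearZ_LR.
rewrite e2 -(scaleK (N n.+1 (b' n (N n phi))) n.+1) scalerMnr -N_b_N.
by rewrite -scalerMnr -e1 -scalerMnr scaleK.
Qed.

Lemma N_bh n (phi : V n) : N n.+1 (bh n phi) = b n (Nh n phi).
Proof. by rewrite bhE NhE !linearZ_LR N_b'. Qed.

Lemma bh_N n (phi : V n) : bh n (N n phi) = b' n (Nh n phi).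
Proof. by rewrite bhE NhE !linearZ_LR. Qed.

Lemma b_N_sh n (phi : V n.+1) : b n (N n (sh n phi)) = Nh n.+1 (b' n (s n phi)).
Proof. by rewrite shE NhE !linearZ_LR N_b'. Qed.

Lemma sh_N n (phi : V n.+1) : sh n (N n.+1 phi) = s n (Nh n.+1 phi).
Proof. by rewrite shE NhE !linearZ_LR. Qed.

Lemma N_s_bh n (phi : V n) : N n (s n (bh n phi)) = Nh n (s n (b' n phi)).
Proof. by rewrite bhE NhE !linearZ_LR. Qed.

Lemma b'_bh n (phi : V n) : b' n.+1 (bh n phi) = 0.
Proof. by rewrite bhE linearZ_LR b'_b' ?scaler0. Qed.

(** * The cochain map *)

Definition lead_component m : {linear CTnat C m -> V m} :=
  match m return {linear CTnat C m -> V m} with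
  | 0 => (idfun : {linear V 0 -> V 0})
  | 1 => (idfun : {linear V 1 -> V 1})
  | n.+2 => (fst : {linear (V n.+2 * CTnat C n)%type -> V n.+2})
  end.

Local Notation top := lead_component.

(** nu before the final composition with hatN. One step down the tail
    composes with - hatb' hatD b, whose transpose is - b D bh; the common
    factor b D is taken out of this term and of the transpose b D s' (1 - tau)
    of (1 - tau) s' hatD b. *)
Fixpoint nu_unaveraged m : {linear CTnat C m -> V m} :=
  match m return {linear CTnat C m -> V m} with
  | 0 => (idfun : {linear V 0 -> V 0})
  | 1 => (idfun : V 1 -> V 1) \- (b 0 \o D 0 \o s 0 \o q 1)
  | n.+2 => fst \- (b n.+1 \o D n.+1 \o
              ((s n.+1 \o q n.+2 \o fst) \+ (bh n \o nu_unaveraged n \o snd)))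
  end.

Local Notation Phi := nu_unaveraged.

Definition pre_correction n : {linear CTnat C n.+1 -> V n} :=
  match n return {linear CTnat C n.+1 -> V n} with
  | 0 => s 0 \o q 1
  | n.+1 => (s n.+1 \o q n.+2 \o fst) \+ (bh n \o Phi n \o snd)
  end.

Local Notation w := pre_correction.

(** Phi and the leading component differ by b of this
    cochain, which is therefore also the natural candidate for the leading
    component of the homotopy. *)
Definition correction n : {linear CTnat C n.+1 -> V n} := D n \o w n.

Local Notation A := correction.

Lemma PhiS n (phi : CTnat C n.+1) : Phi n.+1 phi = top n.+1 phi - b n (A n phi).
Proof. by case: n phi. Qed.

Lemma AE n (phi : CTnat C n.+1) : A n phi = D n (w n phi).
Proof. by []. Qed.

Lemma wS n (phi : CTnat C n.+2) :
  w n.+1 phi = s n.+1 (q n.+2 phi.1) + bh n (Phi n phi.2).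
Proof. by []. Qed.

(** In the cyclic bicomplex the homotopy also inverts N, from a column b' to the
    next column b; this is its trace on the total complex. It is available
    only for the components below the leading one. *)
Definition shift_part n : {linear CTnat C n.+1 -> V n} :=
  N n \o sh n \o Phi n.+1.

Local Notation G := shift_part.

Lemma GE n (phi : CTnat C n.+1) : G n phi = N n (sh n (Phi n.+1 phi)).
Proof. by []. Qed.

Definition lead_injection m : {linear V m -> CTnat C m} := @CTnat_head k C m.

Local Notation head := lead_injection.
Local Notation d := (CTnat_d C).

Lemma d_fst n (phi : CTnat C n.+2) : (d n.+2 phi).1 = b n.+2 phi.1.
Proof. by []. Qed.

Lemma d_snd n (phi : CTnat C n.+2) :
  (d n.+2 phi).2 = head n.+1 (B n.+1 phi.1) + d n phi.2.
Proof. by []. Qed.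

Lemma top_d m (phi : CTnat C m) : top m.+1 (d m phi) = b m (top m phi).
Proof. by case: m phi => [|[]]. Qed.

Lemma top_head m (psi : V m) : top m (head m psi) = psi.
Proof. by case: m psi => [|[]]. Qed.

Lemma w_head n (psi : V n.+1) : w n (head n.+1 psi) = s n (q n.+1 psi).
Proof. by case: n psi => [|n] psi //; rewrite wS /= !linear0 addr0. Qed.

Lemma q_B n (psi : V n.+1) : q n (B n psi) = 0.
Proof. by rewrite BE q_N. Qed.

Lemma Phi_head m (psi : V m) : q m psi = 0 -> Phi m (head m psi) = psi.
Proof.
case: m psi => [|m] psi q0 //.
by rewrite PhiS top_head AE w_head q0 !linear0 addr0.
Qed.

Lemma b'_w n (phi : CTnat C n.+1) :
  b' n (w n phi) = b' n (s n (q n.+1 (top n.+1 phi))).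
Proof.
by case: n phi => [|n] phi //; rewrite wS linearD b'_bh addr0.
Qed.

(** Since Phi = top - b A, the value of A on coboundaries determines that of
    Phi, by b b = 0. The two identities A_d and Phi_d are then proved by a
    single induction. *)
Lemma Phi_d_of_A_d m (phi : CTnat C m) :
  A m (d m phi) = Phi m phi - Nh m (Phi m phi) ->
  Phi m.+1 (d m phi) = b m (Nh m (Phi m phi)).
Proof.
move=> Ad; rewrite PhiS top_d Ad linearB.
case: m phi {Ad} => [|m] phi; first by rewrite /= opprB addrCA subrr addr0.
rewrite {1}PhiS [b _ (top _ _ - _)]linearB b_b subr0 opprB addrCA.
by rewrite subrr addr0.
Qed.

(** With b A added on both sides this is the leading component of the homotopy
    relation, up to the shift part. *)
Lemma A_d m (phi : CTnat C m) : A m (d m phi) = Phi m phi - Nh m (Phi m phi).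
Proof.
(* (1 - hatN) Phi = D (1 - tau) Phi, so both sides have the form D _ and it
   suffices to compute (1 - tau) Phi. *)
have core n (psi : CTnat C n.+1) :
    q n.+1 (Phi n.+1 psi) = s n.+1 (b' n.+1 (q n.+1 (top n.+1 psi)))
       + bh n (N n (w n psi)).
  rewrite PhiS linearB q_b AE q_D [b' n (_ - _)]linearB opprB b'_w -bh_N s_b'.
  by rewrite addrA addrAC.
elim/ltn_ind: m phi => -[|[|m]] IHm phi.
- by rewrite AE -D_q -[w 0 _]/(s 0 (q 1 (b 0 phi))) q_b s_b'0.
- rewrite -D_q core AE -[w 1 _]/(s 1 (q 2 (b 1 phi)) + bh 0 (B 0 phi)).
  by rewrite q_b BE.
rewrite -D_q core AE wS d_fst d_snd q_b [Phi _ (_ + _)]linearD Phi_head ?q_B //.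
rewrite (Phi_d_of_A_d (IHm m _ _)) // BE wS.
by rewrite !linearD N_bh.
Qed.

Lemma Phi_d m (phi : CTnat C m) : Phi m.+1 (d m phi) = b m (Nh m (Phi m phi)).
Proof. exact/Phi_d_of_A_d/A_d. Qed.

(** The contribution of the leading component of phi to the component below:
    all that survives is what the truncation at the leading component of
    the tail would leave as a defect. *)
Lemma B_A n (phi : CTnat C n.+2) :
  B n (A n.+1 phi) + G n (head n.+1 (B n.+1 phi.1)) =
  Nh n (s n (b' n (Phi n phi.2))) - G n (d n phi.2).
Proof.
rewrite BE AE q_D wS !GE Phi_d Phi_head ?q_B // BE -N_bh !sh_N.
rewrite -N_s_bh !(linearB, linearD) s_s linear0 add0r.
by rewrite -addrA [X in _ + X]addrAC addNr add0r.
Qed.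

(** * The homotopy *)

(** The homotopy that the periodic complex, with no leading component, would
    have: every component gets the same formula A + G. *)
Fixpoint periodic_homotopy_fun m : CTnat C m.+1 -> CTnat C m :=
  match m return CTnat C m.+1 -> CTnat C m with
  | 0 => fun phi => A 0 phi + G 0 phi
  | 1 => fun phi => A 1 phi + G 1 phi
  | n.+2 => fun phi => (A n.+2 phi + G n.+2 phi, @periodic_homotopy_fun n phi.2)
  end.

Lemma periodic_homotopy_fun_linear m : linear (@periodic_homotopy_fun m).
Proof.
elim/ltn_ind: m => -[|[|m]] IHm a phi psi.
- transitivity (A 0 (a *: phi + psi) + G 0 (a *: phi + psi)) => //.
  by rewrite !linearP addrACA -scalerDr.
- transitivity (A 1 (a *: phi + psi) + G 1 (a *: phi + psi)) => //.
  by rewrite !linearP addrACA -scalerDr.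
transitivity ((A m.+2 (a *: phi + psi) + G m.+2 (a *: phi + psi),
  @periodic_homotopy_fun m (a *: phi.2 + psi.2)) : CTnat C m.+2) => //.
by rewrite IHm // !linearP addrACA -scalerDr.
Qed.

HB.instance Definition _ m :=
  GRing.isLinear.Build k^c (CTnat C m.+1) (CTnat C m) _
    (@periodic_homotopy_fun m) (@periodic_homotopy_fun_linear m).

Definition periodic_homotopy m : {linear CTnat C m.+1 -> CTnat C m} :=
  @periodic_homotopy_fun m.

Local Notation W := periodic_homotopy.

(** In degree 0 the map W would land in degree -1, where the complex vanishes. *)
Definition dW m : CTnat C m -> CTnat C m :=
  match m with
  | 0 => fun=> 0
  | n.+1 => fun phi => d n (W n phi)
  end.

(** In the periodic complex W would be a contraction. The truncated complex
    loses the terms through the component above the leading one; they amount to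
    this cochain. *)
Definition truncation_defect m (phi : CTnat C m) : V m :=
  Nh m (s m (b' m (Phi m phi))) - G m (d m phi).

Lemma dW_fst m (phi : CTnat C m.+2) :
  (dW phi).1 = b m.+1 (A m.+1 phi + G m.+1 phi).
Proof. by case: m phi => [|m] phi. Qed.

Lemma dW_snd m (phi : CTnat C m.+2) :
  (dW phi).2 = head m (B m (A m.+1 phi + G m.+1 phi)) + dW phi.2.
Proof. by case: m phi => [|m] phi //=; rewrite addr0. Qed.

Lemma W_head m (psi : V m.+1) :
  W m (head m.+1 psi) =
  head m (A m (head m.+1 psi) + G m (head m.+1 psi)).
Proof.
case: m psi => [|[|m]] psi //.
transitivity ((A m.+2 (head m.+3 psi) + G m.+2 (head m.+3 psi), W m 0)
  : CTnat C m.+2) => //.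
by rewrite linear0.
Qed.

Lemma B_G m (phi : CTnat C m.+2) : B m (G m.+1 phi) = 0.
Proof. by rewrite BE GE q_N !linear0. Qed.

Lemma A_head_B m (psi : V m.+2) : A m (head m.+1 (B m.+1 psi)) = 0.
Proof. by rewrite AE w_head q_B !linear0. Qed.

(** The leading component combines A_d with the defining property of s'. In
    the lower ones the defect of the tail, given by induction, is compensated by
    the leading component of phi, by B_A. *)
Lemma periodic_homotopyP m (phi : CTnat C m) :
  dW phi + W m (d m phi) = phi - head m (truncation_defect phi).
Proof.
have core n (psi : CTnat C n.+1) :
    b n (A n psi + G n psi) + (A n.+1 (d n.+1 psi) + G n.+1 (d n.+1 psi)) =
    top n.+1 psi - truncation_defect psi.
  have -> : top n.+1 psi = Phi n.+1 psi + b n (A n psi) by rewrite PhiS subrK.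
  rewrite A_d /truncation_defect s_b' [b n (_ + _)]linearD [b n (G _ _)]b_N_sh.
  rewrite [Nh n.+1 (_ - _)]linearB /= !opprB.
  by rewrite [LHS](AC (2*(2*1)) ((3*1)*(5*(2*4)))).
elim/ltn_ind: m phi => -[|[|m]] IHm phi.
- rewrite -[LHS]/(0 + (A 0 (d 0 phi) + G 0 (d 0 phi))) A_d.
  by rewrite /truncation_defect s_b'0 add0r opprB addrA addrAC.
- exact: core.
have e1 := core _ phi.
have e2 : (dW phi).2 + (W m.+2 (d m.+2 phi)).2 = phi.2.
  rewrite dW_snd -[(W m.+2 _).2]/(W m (d m.+2 phi).2) d_snd.
  rewrite [W m _]linearD W_head A_head_B add0r [B m _]linearD B_G addr0.
  by rewrite addrACA -linearD B_A IHm // addrC subrK.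
rewrite [phi - _]surjective_pairing [LHS]surjective_pairing.
congr pair; last by rewrite [LHS]e2 [RHS]subr0.
by rewrite -[LHS]/((dW phi).1 + _) dW_fst; exact: e1.
Qed.

(** Minus W with its shift part removed from the leading component, where there
    is no column b' to come from. The sign gives iota nu - 1 rather than
    1 - iota nu. *)
Definition nu_homotopy m : {linear CTnat C m.+1 -> CTnat C m} :=
  (head m \o G m) \- W m.

(** The coboundary of a leading component psi also has the component B psi, which
    vanishes here because G takes tau-invariant values. *)
Lemma d_head_G m (phi : CTnat C m.+1) :
  d m (head m (G m phi)) = head m.+1 (b m (G m phi)).
Proof.
case: m phi => [|[|m]] phi //.
  by rewrite -[LHS]/(b 1 (G 1 phi), B 0 (G 1 phi)) B_G.
rewrite -[LHS]/(b m.+2 (G m.+2 phi), head m.+1 (B m.+1 (G m.+2 phi)) + d m 0).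
by rewrite B_G !linear0 addr0.
Qed.

Lemma nu_homotopy0 (phi : CTnat C 0) :
  head 0 (Nh 0 (Phi 0 phi)) - phi = nu_homotopy 0 (d 0 phi).
Proof.
have e : 0 + W 0 (d 0 phi) = phi - head 0 (truncation_defect phi) :=
  periodic_homotopyP phi.
rewrite -[RHS]/(head 0 (G 0 (d 0 phi)) - W 0 (d 0 phi)) -[W 0 _]add0r e.
rewrite /truncation_defect s_b'0 [head 0 (_ - _)]linearB !opprB addrA.
by rewrite [_ + (_ - _)]addrC subrK.
Qed.

Lemma nu_homotopyS m (phi : CTnat C m.+1) :
  head m.+1 (Nh m.+1 (Phi m.+1 phi)) - phi =
  d m (nu_homotopy m phi) + nu_homotopy m.+1 (d m.+1 phi).
Proof.
have e : d m (W m phi) + W m.+1 (d m.+1 phi) =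
    phi - head m.+1 (truncation_defect phi) :=
  periodic_homotopyP phi.
rewrite -[nu_homotopy m phi]/(head m (G m phi) - W m phi).
rewrite -[nu_homotopy m.+1 _]/(
  head m.+1 (G m.+1 (d m.+1 phi)) - W m.+1 (d m.+1 phi)).
rewrite [d m (_ - _)]linearB addrACA -opprD e d_head_G /truncation_defect s_b'.
rewrite ![Nh _ (_ - _)]linearB -b_N_sh -GE.
rewrite ![head _ (_ - _)]linearB !opprB.
rewrite -[_ - _ - head _ (G _ _)]addrA -opprD addrA.
by rewrite [_ + (head _ (Nh _ _) - _)]addrC subrK.
Qed.

(** * Cyclic cochains *)

Lemma hatN_tau m (phi : V m) x : phi (hatN rk (tau x)) = phi (hatN rk x).
Proof.
have hN : hatN rk (one_sub_tau x) = inv_nat rk m.+1 *: (x - opT x).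
  by rewrite /hatN opN_one_sub_tau.
have -> : hatN rk (tau x) = hatN rk x - hatN rk (one_sub_tau x).
  by rewrite -[RHS](linearB (@hatN k rk C m)) subKr.
rewrite hN.
have phi0 : phi (inv_nat rk m.+1 *: (x - opT x)) = 0.
  transitivity (inv_nat rk m.+1 * (phi x - phi (opT x))).
    by rewrite linearZ_LR linearB.
  by rewrite inv_homP subrr mulr0.
by rewrite linearB /= phi0 subr0.
Qed.

Definition cyclic_average m : {linear V m -> Clam C m} :=
  pullback (@hatN_tau m).

Lemma Clam_CT_average m (phi : V m) :
  Clam_CT C m (cyclic_average m phi) = Nh m phi.
Proof. exact: CT_ext. Qed.

Lemma Clam_CT_inj m : injective (Clam_CT C m).
Proof.
move=> phi psi e; apply/val_inj/funext => x.
exact: (congr1 (fun f : V m => f x) e).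
Qed.

Lemma Clam_CT_b m (phi : Clam C m) :
  Clam_CT C m.+1 (Clam_b C m phi) = b m (Clam_CT C m phi).
Proof. exact: CT_ext. Qed.

Lemma q_Clam m (phi : Clam C m) : q m (Clam_CT C m phi) = 0.
Proof.
apply: CT_ext => x; rewrite -[LHS]/(phi (one_sub_tau x)).
by rewrite linearB /= inv_homP subrr.
Qed.

Lemma Nh_cyc m (phi : V m) : q m phi = 0 -> Nh m phi = phi.
Proof.
by move=> q0; apply/eqP; rewrite eq_sym -subr_eq0 -D_q q0 linear0.
Qed.

Lemma nu_factor_dual n (psi : V n.+1) (x : C n.+1) :
  (psi - b n (D n (s n (q n.+1 psi)))) x = psi (nu_factor rk x).
Proof. by symmetry; exact: (linearB psi). Qed.

(** Dropping the leading component shifts the powers of hatb' hatD b by one, with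
    a sign: this is the recursion of Phi. *)
Lemma Phi_formula m (phi : CTnat C m) (x : C m) :
  Phi m phi x = \sum_(j < m./2.+1)
    (-1) ^+ j * CTnat_comp j phi (nu_factor rk (hatbDb_iter rk j x)).
Proof.
elim/ltn_ind: m phi x => -[|[|m]] IHm phi x.
- by rewrite big_ord_recl big_ord0 addr0 mul1r.
- by rewrite big_ord_recl big_ord0 addr0 mul1r; exact: nu_factor_dual.
rewrite big_ord_recl mul1r.
transitivity (phi.1 (nu_factor rk x) - Phi m phi.2 (hatbDb rk x)).
  rewrite -nu_factor_dual PhiS AE wS [D _ (_ + _)]linearD [b _ (_ + _)]linearD.
  by rewrite opprD addrA.
congr (_ + _); rewrite IHm // -sumrN; apply: eq_bigr => j _.
by rewrite lift0 exprS mulN1r mulNr.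
Qed.

End Dual.

Theorem proposition12p1 (k : nzRingType) (rk : {rmorphism rat -> k})
    (C : hunital k) :
  exists nu : forall m, {linear CTnat C m -> Clam C m},
    [/\ forall m (phi : CTnat C m) (x : C m),
          nu m phi x = nu_formula rk phi x,
        is_cochain_map (CTnat_d C) (Clam_b C) nu,
        forall m (phi : Clam C m), nu m (iota_nat C m phi) = phi
      & cochain_homotopic (CTnat_d C) (CTnat_d C)
          (fun m => iota_nat C m \o nu m) (fun m => idfun)].
Proof.
exists (fun m => cyclic_average rk m \o nu_unaveraged rk m); split.
- by move=> m phi x; exact: (Phi_formula rk phi (hatN rk x)).
- move=> m phi; apply: Clam_CT_inj; rewrite Clam_CT_b /= !Clam_CT_average Phi_d.
  by rewrite Nh_cyc // q_b q_Nh linear0.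
- move=> m phi; apply: Clam_CT_inj; rewrite /= Clam_CT_average.
  by rewrite Phi_head ?q_Clam // Nh_cyc ?q_Clam.
exists (nu_homotopy rk); split=> [phi|m phi]; rewrite /= Clam_CT_average.
  exact: nu_homotopy0.
exact: nu_homotopyS.
Qed.
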